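(* Let $S\subseteq\mathbb{N}$ satisfy $\gcd(S+1)=1$, where $S+1=\{n+1:n\in S\}$. Let $X_S$ be the $S$-gap subshift, let $\mu$ be the unique measure of maximal entropy on $X_S$, and let $\lambda=e^{h_{top}(X_S)}$. Then $$\lim_{n\to\infty}\frac{|L_n(X_S)|}{\lambda^n}$$ exists and is equal to $\dfrac{\mu(1)\lambda}{(\lambda-1)^2}$ when $S$ is infinite, and to $\dfrac{\mu(1)\lambda\,\bigl(1-\lambda^{-(\max S)-1}\bigr)^2}{(\lambda-1)^2}$ when $S$ is finite.
   Context: A $\mathbb{Z}$-subshift is a closed shift-invariant subset $X\subseteq\mathcal{A}^{\mathbb{Z}}$, where $\mathcal{A}$ is a finite alphabet. $L_n(X)$ is the set of words of length $n$ occurring in points of $X$, and $h_{top}(X)=\lim_{n\to\infty}\frac1n\log|L_n(X)|$. For a shift-invariant Borel probability measure $\mu$ on $X$ and a word $w$ of length $n$, $\mu(w)=\mu(\{x\in X: x_{[0,n)}=w\})$; in particular $\mu(1)$ is the measure of $\{x: x_0=1\}$. The entropy of $\mu$ is $h_\mu(X)=\lim_{n\to\infty}\frac1n\sum_{w\in\mathcal{A}^n}-\mu(w)\log\mu(w)$, and $\mu$ is a measure of maximal entropy if $h_\mu(X)=h_{top}(X)$. For $S\subseteq\mathbb{N}\cup\{0\}$, the $S$-gap subshift $X_S\subseteq\{0,1\}^{\mathbb{Z}}$ is defined by the set of forbidden words $\{10^n1: n\notin S\}$; alternately, $X_S$ is the set of bi-infinite $\{0,1\}$ sequences where the gap (number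 of $0$s) between any two nearest $1$s has length in $S$. It is known that $X_S$ has a unique measure of maximal entropy.
   Formalization: For finite S, X_S is taken to forbid also runs of 0s longer than max S (so 1 occurs infinitely often in both directions); with only the words 10^n1, n not in S, forbidden, the stated limit for finite S is false, e.g. S={1,2}. Infinite S is unchanged. *)

(* Defs.v *)
From HB Require Import structures.
From mathcomp Require Import all_boot all_order all_algebra finmap.
From mathcomp Require Import all_classical all_reals all_analysis.

Set Implicit Arguments.
Unset Strict Implicit.
Unset Printing Implicit Defensive.

Import Order.TTheory GRing.Theory Num.Theory.
Import numFieldNormedType.Exports.

Local Open Scope classical_set_scope.
Local Open Scope ring_scope.

(* {0,1}^Z with the product of the discrete topologies; the symbol 1 is
   [true] and 0 is [false]. *)
Notation full_shift := (prod_topology (fun _ : int => bool)).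

Definition shift (x : full_shift) : full_shift := fun i => x (i + 1).

Definition occurs_at (x : full_shift) (i : int) (w : seq bool) : Prop :=
  forall k : nat, (k < size w)%N -> x (i + k%:Z) = nth false w k.

Definition occurs (x : full_shift) (w : seq bool) : Prop :=
  exists i : int, occurs_at x i w.

Definition avoiding (F : set (seq bool)) : set full_shift :=
  [set x | forall w, F w -> ~ occurs x w].

Definition in_language (X : set full_shift) (w : seq bool) : Prop :=
  exists2 x, X x & occurs x w.

(* |L_n(X)| *)
Definition complexity (X : set full_shift) (n : nat) : nat :=
  #|[pred w : n.-tuple bool | `[< in_language X w >]]|.

Definition htop (R : realType) (X : set full_shift) : R :=
  limn (fun n : nat => n%:R^-1 * ln ((complexity X n)%:R : R)).

Notation borel_full_shift := (g_sigma_algebraType (@open full_shift)).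

(* A probability measure on a subshift X is a probability measure on the
   full shift that gives mass 1 to X. *)
Definition invariant_on (R : realType) (X : set full_shift)
    (mu : probability borel_full_shift R) : Prop :=
  mu X = 1%E /\
  forall B : set borel_full_shift, measurable B -> mu (shift @^-1` B) = mu B.

(* mu(w) *)
Definition word_measure (R : realType) (X : set full_shift)
    (mu : probability borel_full_shift R) (w : seq bool) : R :=
  fine (mu [set x | X x /\ occurs_at x 0 w]).

Definition entropy (R : realType) (X : set full_shift)
    (mu : probability borel_full_shift R) : R :=
  limn (fun n : nat => n%:R^-1 *
    \sum_(w : n.-tuple bool) - (word_measure X mu w * ln (word_measure X mu w))).

Definition max_entropy_measure (R : realType) (X : set full_shift)
    (mu : probability borel_full_shift R) : Prop :=
  invariant_on X mu /\ entropy X mu = htop R X.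

(* The S-gap shift forbids the words 1 0^n 1 with n \notin S.  When S is finite
   it also forbids runs of 0s longer than max S, including the unbounded runs
   that are not enclosed between two 1s: every point has infinitely many 1s in
   both directions.  When S is infinite the second family is empty. *)
Definition gap_forbidden (S : set nat) : set (seq bool) :=
  [set w | exists2 n, ~ S n & w = true :: rcons (nseq n false) true] `|`
  [set w | exists2 n, (forall s, S s -> (s < n)%N) & w = nseq n false].

Definition gap_shift (S : set nat) : set full_shift :=
  avoiding (gap_forbidden S).

Definition is_gcd (D : set nat) (g : nat) : Prop :=
  (forall n, D n -> (g %| n)%N) /\
  (forall d, (forall n, D n -> (d %| n)%N) -> (d %| g)%N).

(* Meaningful for finite nonempty S only: [fset_set] is empty on infinite sets. *)
Definition max_set (S : set nat) : nat := (\max_(s <- fset_set S) s)%N.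

(* Main.v *)
Require Import Defs.
From HB Require Import structures.
From mathcomp Require Import all_boot all_order all_algebra finmap.
From mathcomp Require Import all_classical all_reals all_analysis.
From mathcomp Require Import zify ring lra.

(** Let x in ]0, 1[ solve [\sum_(s in S) x ^ s.+1 = 1]; such an x exists because S
    has at least two elements ([gap_two], [root_exists]).  Then
    [q s := x ^ s.+1] for s in S is a probability distribution on the gaps; let
    [M := \sum_k (1 - \sum_(j < k) q j)] be the mean of s.+1 under q, that is, the
    mean distance between consecutive 1s.

    Counting.  A word of the language is either a block of 0s no longer than some
    gap or has the form 0^a 1 ... 1 0^b with a and b bounded by some gap and all
    inner gaps in S ([in_languageP]).  Reading words from left to right, the number t n of
    words that may follow a 1 satisfies, after multiplication by x ^ n, the
    renewal equation [t = e + q * t], where [e n = x ^ n] if n is bounded by some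
    gap and 0 otherwise.  The renewal theorem of Erdos, Feller and Pollard
    ([renewal]), in which the gcd condition is the aperiodicity assumption, gives
    [t --> B / M] with [B := \sum_n e n].  Adding the initial block of 0s yields
    [|L_n| * x ^ n --> x * B ^ 2 / M] ([partition_cvg]).  This limit is positive,
    so the topological entropy is - ln x and lambda = 1 / x ([htop_of_cvg]).  The
    two formulas come from the two values of B: 1 / (1 - x) when S is infinite,
    (1 - x ^ (max S).+1) / (1 - x) when S is finite.

    The measure of a symbol.  What remains is that p := mu(1) equals 1 / M.  Weight
    a word w of length n by z ^ n * c ^ (number of 1s in w).  As soon as
    [c * \sum_(s in S) z ^ s.+1 <= 1], the sum of these weights over L_n is bounded
    ([before_one_sum_bounded]), and Gibbs' inequality turns this into
    [h(mu) <= - ln z - p * ln c] ([entropy_le]): invariance enters only through the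
    mean number n * p of 1s in a word of length n.  With c the inverse of the
    above sum, the right-hand side is a function of z whose value at z = x, where
    c = 1, is - ln x, which is h(mu) because mu has maximal entropy.  So z = x is a
    minimum, and the vanishing of the derivative there reads p * M = 1
    ([density_mean_gap]).  This replaces the usual appeal to the uniqueness of the
    measure of maximal entropy. *)

Set Implicit Arguments.
Unset Strict Implicit.
Unset Printing Implicit Defensive.

Import Order.TTheory GRing.Theory Num.Theory.
Import numFieldNormedType.Exports.

Local Open Scope classical_set_scope.
Local Open Scope ring_scope.

(** * Series and convolutions *)

Lemma cvg_epsP (R : realType) (u : nat -> R) (l : R) :
  u @ \oo --> l <->
  forall e, 0 < e -> exists N, forall n, (N <= n)%N -> `|u n - l| <= e.
Proof.
split=> [/cvgrPdist_le ul e e0|ul].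
  have [N _ Nu] := ul e e0.
  by exists N => n Nn; rewrite distrC; exact: Nu.
apply/cvgrPdist_le => e e0; have [N Nu] := ul e e0.
by exists N => // n Nn; rewrite distrC; exact: Nu.
Qed.

(** Let d be the least positive difference b' - b of two elements of P.  The
    remainder modulo d of an element of D is again such a difference, hence 0, so
    that d divides all of D and d = 1.  From b and b + 1 in P one reaches every
    n >= b * b as a combination of both. *)
Lemma additive_cofinite (P : nat -> Prop) (D : set nat) :
  P 0%N -> (forall a b, P a -> P b -> P (a + b)%N) ->
  (forall d, D d -> P d) -> is_gcd D 1 ->
  exists A, forall n, (A <= n)%N -> P n.
Proof.
move=> P0 PD DP [_ gcdD].
have PM a k : P a -> P (k * a)%N.
  by move=> Pa; elim: k => [|k IH]; rewrite ?mul0n// mulSn; exact: PD.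
pose diff d := `[< exists2 b, P b & P (b + d)%N >].
have exdiff : exists d, diff d && (0 < d)%N.
  apply: contrapT => /forallNP noD.
  suff : (2 %| 1)%N by [].
  apply: gcdD => d /DP Pd; case: d Pd => [//|d] Pd; case: (noD d.+1).
  by rewrite andbT; apply/asboolP; exists 0%N; rewrite ?add0n.
have [d /andP[/asboolP[b Pb Pbd] d0] mind] := ex_minnP exdiff.
have d1 : d = 1%N.
  apply/eqP; rewrite -dvdn1; apply: gcdD => s /DP Ps; rewrite /dvdn.
  apply: contraT => r0; have := mind (s %% d)%N.
  rewrite lt0n r0 andbT => /(_ _); rewrite leqNgt ltn_mod d0.
  apply; apply/asboolP; exists (s %/ d * (b + d))%N; first exact: PM.
  have -> : (s %/ d * (b + d) + s %% d = s + s %/ d * b)%N.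
    by rewrite mulnDr -addnA -divn_eq addnC.
  by apply: PD => //; exact: PM.
rewrite d1 in Pbd.
have [b0|b0] := posnP b.
  by exists 0%N => n _; rewrite -(muln1 n); apply: PM; rewrite b0 in Pbd.
exists (b * b)%N => n bn.
have jb : (n %% b <= n %/ b)%N.
  by rewrite (leq_trans (ltnW (ltn_pmod n b0)))// leq_divRL.
have -> : n = ((n %/ b - n %% b) * b + (n %% b) * (b + 1))%N.
  by rewrite mulnDr muln1 addnA -mulnDl subnK// -divn_eq.
by apply: PD; exact: PM.
Qed.

Section Renewal.
Variable R : realType.
Implicit Types (a q b u v : nat -> R) (C L : R).

(** The convolution of a and v, delayed by one step: entry j of a stands for a
    block of length j.+1, namely j zeros and a one. *)
Definition lagconv a v n := \sum_(0 <= j < n) a j * v (n - j.+1)%N.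

Lemma limsup_exists v C : (forall n, `|v n| <= C) ->
  exists L, (forall e, 0 < e -> exists N, forall n, (N <= n)%N -> v n <= L + e) /\
            (forall e N, 0 < e -> exists2 n, (N <= n)%N & L - e <= v n).
Proof.
move=> vC; pose E := [set y | exists N, forall n, (N <= n)%N -> v n <= y].
have EC : E C by exists 0%N => n _; rewrite (le_trans (ler_norm _)).
have lbE : lbound E (- C).
  move=> y [N /(_ N (leqnn N))]; apply: le_trans.
  by have := vC N; rewrite ler_norml => /andP[].
have infE : has_inf E by split; [exists C|exists (- C)].
exists (inf E); split=> [e e0|e N e0].
  have [y [N Ny] ye] := inf_adherent e0 infE.
  by exists N => n /Ny /le_trans; apply; exact: ltW.
apply: contrapT => noN; have : E (inf E - e).
  exists N => n Nn; rewrite leNgt; apply/negP => vn.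
  by apply: noN; exists n => //; exact: ltW.
by move=> /(ge_inf infE.2); lra.
Qed.

Lemma series_ge0_homo a (a0 : forall n, 0 <= a n) m n :
  (m <= n)%N -> series a m <= series a n.
Proof.
move=> mn; exact: (@nondecreasing_series R a xpredT 0%N (fun n _ _ => a0 n) m n mn).
Qed.

Lemma series_le_lim a (a0 : forall n, 0 <= a n) A :
  series a @ \oo --> A -> forall n, series a n <= A.
Proof.
move=> aA n; rewrite -(cvg_lim (@Rhausdorff R) aA).
apply: nondecreasing_cvgn_le; last by apply/cvg_ex; exists A.
by move=> m p; exact: series_ge0_homo.
Qed.

(** The quantitative form of the fact that late values of v dominate the
    convolution: the values of v before N are only met by the tail of a from
    n - N on. *)
Lemma lagconv_tail_bound a v (N : nat) (e C : R) n (P : pred nat) :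
  (forall j, 0 <= a j) -> 0 <= e -> 0 <= C ->
  (forall m, (N <= m)%N -> v m <= e) -> (forall m, v m <= C) ->
  \sum_(0 <= j < n | P j) a j * v (n - j.+1)%N <=
  series a n * e + C * (series a n - series a (n - N)%N).
Proof.
move=> a0 e0 C0 ve vC.
have split_series : series a n - series a (n - N)%N =
    \sum_(0 <= j < n) a j * (n - N <= j)%N%:R.
  rewrite /series/= (big_cat_nat (leq0n _) (leq_subr N n))//= addrAC subrr add0r.
  rewrite [RHS](big_cat_nat (leq0n _) (leq_subr N n))/=.
  rewrite [X in _ = X + _]big_nat_cond [X in _ = X + _]big1 ?add0r.
    by apply: eq_big_nat => j /andP[-> _]; rewrite mulr1.
  by move=> j /andP[/andP[_ jn] _]; rewrite leqNgt jn mulr0.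
rewrite split_series {1}/series/= mulr_suml mulr_sumr -big_split/=.
rewrite big_mkcond/= ; apply: ler_sum_nat => j /andP[_ jn].
rewrite mulrCA -mulrDr; case: ifP => _; last first.
  by rewrite mulr_ge0 ?addr_ge0 ?mulr_ge0.
apply: ler_wpM2l => //; have [nj|jnN] := leqP (n - N)%N j.
  by rewrite mulr1 (le_trans (vC _))// lerDr.
by rewrite mulr0 addr0 ve//; lia.
Qed.

Lemma cvg_lagconv a u (A l : R) : (forall j, 0 <= a j) ->
  series a @ \oo --> A -> u @ \oo --> l -> lagconv a u @ \oo --> A * l.
Proof.
move=> a0 aA ul.
have A0 : 0 <= A by apply: le_trans (series_le_lim a0 aA 0); rewrite /series/= big_geq.
have [C Cu] : exists C, forall n, `|u n - l| <= C.
  have [N Nu] := (cvg_epsP _ _).1 ul 1 ltr01.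
  exists (1 + \sum_(0 <= i < N) `|u i - l|) => n.
  have [/Nu un|nN] := leqP N n.
    by apply: le_trans un _; rewrite lerDl sumr_ge0.
  rewrite (bigD1_seq n) ?mem_iota ?iota_uniq ?subn0//=.
  by rewrite addrCA lerDl addr_ge0 ?sumr_ge0.
have C0 : 0 <= C by apply: le_trans (Cu 0%N).
apply/cvg_epsP => e e0.
pose d := e / (A + `|l| + C + 1).
have D0 : 0 < A + `|l| + C + 1 by rewrite ltr_wpDl// !addr_ge0.
have d0 : 0 < d by rewrite divr_gt0.
have [N Nu] := (cvg_epsP _ _).1 ul d d0.
have [N1 Na] := (cvg_epsP _ _).1 aA d d0.
have seriesA n : (N1 <= n)%N -> A - d <= series a n.
  by move=> /Na; rewrite ler_norml => /andP[+ _]; lra.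
exists (N + N1)%N => n nN.
have -> : lagconv a u n - A * l = lagconv a (fun m => u m - l) n + (series a n - A) * l.
  rewrite /lagconv/= [X in _ = X + _](eq_bigr (fun j => a j * u (n - j.+1)%N - a j * l)).
    by rewrite sumrB -mulr_suml /series/=; ring.
  by move=> j _; rewrite mulrBr.
apply: (le_trans (ler_normD _ _)).
have h1 : `|lagconv a (fun m => u m - l) n| <= A * d + C * d.
  apply: (@le_trans _ _ (\sum_(0 <= j < n) a j * `|u (n - j.+1)%N - l|)).
    apply: (le_trans (ler_norm_sum _ _ _)); apply: ler_sum => j _.
    by rewrite normrM ger0_norm.
  apply: (le_trans (@lagconv_tail_bound a (fun m => `|u m - l|) N d C n xpredT _ _ _ _ _)) => //.
    exact: ltW.
  apply: lerD; first by apply: ler_wpM2r; [exact: ltW|exact: series_le_lim].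
  apply: ler_wpM2l => //.
  have : A - d <= series a (n - N)%N by apply: seriesA; lia.
  by have := series_le_lim a0 aA n; lra.
have h2 : `|(series a n - A) * l| <= d * `|l|.
  by rewrite normrM ler_wpM2r// Na//; lia.
apply: (le_trans (lerD h1 h2)).
have -> : e = d * (A + `|l| + C + 1) by rewrite divfK// gt_eqF.
by nra.
Qed.

End Renewal.

(** * The renewal theorem *)

Section RenewalTheorem.
Variable R : realType.
Implicit Types (q b u v : nat -> R).

(** A value of v close to its limsup, here 0, is a q-average of earlier values, and
    none of them can be much larger than 0; so v (n - a) is close to the limsup
    for every a with positive weight.  The lags a with this property form an
    additive set, which contains all large integers by the gcd condition; this
    produces arbitrarily long windows of near-maximal values. *)
Let near_limsup0 q v (C : R) (K : nat) (e : R) (N : nat) :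
  (forall j, 0 <= q j) -> series q @ \oo --> (1 : R) ->
  is_gcd [set j.+1 | j in [set j | 0 < q j]] 1 ->
  (forall n, `|v n| <= C) ->
  (fun n => v n - lagconv q v n) @ \oo --> (0 : R) ->
  (forall e, 0 < e -> exists N, forall n, (N <= n)%N -> v n <= e) ->
  (forall e N, 0 < e -> exists2 n, (N <= n)%N & - e <= v n) ->
  0 < e -> exists2 n, (N <= n)%N & forall k, (k <= K)%N -> - e <= v (n - k)%N.
Proof.
move=> q0 q1 gcdq vC def0 vtop vfreq e0.
have C0 : 0 <= C by apply: le_trans (vC 0%N).
pose P a := forall e, 0 < e -> exists2 d, 0 < d &
  exists N, forall n, (N <= n)%N -> - d <= v n -> - e <= v (n - a)%N.
have P0 : P 0%N by move=> f f0; exists f => //; exists 0%N => n _; rewrite subn0.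
have PD a c : P a -> P c -> P (a + c)%N.
  move=> Pa Pc f f0; have [d d0 [Nc Hc]] := Pc f f0.
  have [d' d'0 [Na Ha]] := Pa d d0.
  exists d' => //; exists (Na + Nc + a)%N => n nN vn; rewrite subnDA.
  by apply: Hc; [lia|apply: Ha => //; lia].
have Pq a : [set j.+1 | j in [set j | 0 < q j]] a -> P a.
  move=> [i /= qi <-] f f0; pose h := f * q i / 4.
  have h0 : 0 < h by rewrite divr_gt0 ?mulr_gt0.
  have hC0 : 0 < h / (C + 1) by rewrite divr_gt0// ltr_wpDl.
  have [N1 HN1] := vtop h h0.
  have [N2 HN2] := (cvg_epsP _ _).1 def0 h h0.
  have [N3 HN3] := (cvg_epsP _ _).1 q1 _ hC0.
  (* Beyond this index, the defect, the excess of v over 0 and the mass of q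
     that meets the values before N1 each cost at most h; together with v n >= - h
     they lose 4 * h = q i * f. *)
  exists h => //; exists (N1 + N2 + N3 + i.+1)%N => n nN vn.
  have : `|v n - lagconv q v n - 0| <= h by apply: HN2; lia.
  rewrite subr0 ler_norml => /andP[_].
  rewrite /lagconv (bigD1_seq i) ?mem_iota ?iota_uniq ?subn0//=; last by lia.
  have := @lagconv_tail_bound R q v N1 h C n (fun j => j != i) q0 (ltW h0) C0 HN1
    (fun m => le_trans (ler_norm _) (vC m)).
  have : `|series q (n - N1)%N - 1| <= h / (C + 1) by apply: HN3; lia.
  rewrite ler_norml => /andP[qnN _].
  have qn1 := series_le_lim q0 q1 n.
  have : series q n * h <= h by rewrite -[leRHS]mul1r ler_wpM2r// ltW.
  have : C * (series q n - series q (n - N1)%N) <= h.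
    apply: (@le_trans _ _ (C * (h / (C + 1)))).
      by apply: ler_wpM2l => //; lra.
    rewrite mulrA ler_pdivrMr ?ltr_wpDl//; nra.
  set s := \sum_(_ <- _ | _) _; set t := C * _; set w := _ * h.
  move=> tn wh sle vle.
  have : - (4 * h) <= q i * v (n - i.+1)%N by lra.
  have -> : 4 * h = q i * f by rewrite /h; field.
  by rewrite -mulrN ler_pM2l.
have [A PA] := additive_cofinite P0 PD Pq gcdq.
have [d d0 [N1 HN1]] : exists2 d, 0 < d & exists N, forall n, (N <= n)%N ->
    - d <= v n -> forall k, (k <= K)%N -> - e <= v (n - A - k)%N.
  elim: K => [|K [d d0 [N1 HN1]]].
    have [d d0 [N1 HN1]] := PA A (leqnn A) e e0.
    exists d => //; exists N1 => n nN vn k; rewrite leqn0 => /eqP ->.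
    by rewrite subn0; exact: HN1.
  have [d' d'0 [N2 HN2]] := PA (A + K.+1)%N (leq_addr _ _) e e0.
  exists (Num.min d d'); first by rewrite lt_min d0.
  exists (N1 + N2)%N => n nN vn k.
  have vnd : - d <= v n by rewrite (le_trans _ vn)// lerN2 ge_min lexx.
  have vnd' : - d' <= v n by rewrite (le_trans _ vn)// lerN2 ge_min lexx orbT.
  rewrite leq_eqVlt => /orP[/eqP ->|kK]; last by apply: HN1 => //; lia.
  by rewrite -subnDA; apply: HN2 => //; lia.
have [n nN vn] := vfreq d (N + N1 + A)%N d0.
exists (n - A)%N; first by lia.
by move=> k kK; apply: HN1 => //; lia.
Qed.

(** The renewal equation with vanishing error is stable under subtraction of a
    constant because the total mass of q is 1; this reduces to limsup 0. *)
Lemma renewal_near_limsup q v (C L : R) (K : nat) (e : R) (N : nat) :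
  (forall j, 0 <= q j) -> series q @ \oo --> (1 : R) ->
  is_gcd [set j.+1 | j in [set j | 0 < q j]] 1 ->
  (forall n, `|v n| <= C) ->
  (fun n => v n - lagconv q v n) @ \oo --> (0 : R) ->
  (forall e, 0 < e -> exists N, forall n, (N <= n)%N -> v n <= L + e) ->
  (forall e N, 0 < e -> exists2 n, (N <= n)%N & L - e <= v n) ->
  0 < e -> exists2 n, (N <= n)%N & forall k, (k <= K)%N -> L - e <= v (n - k)%N.
Proof.
move=> q0 q1 gcdq vC def0 vtop vfreq e0.
have [||||n nN Hn] := @near_limsup0 q (fun n => v n - L) (C + `|L|) K e N q0 q1 gcdq _ _ _ _ e0.
- by move=> n; rewrite (le_trans (ler_normB _ _))// lerD.
- have -> : (fun n => v n - L - lagconv q (fun n => v n - L) n) =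
     (fun n => (v n - lagconv q v n) + (series q n - 1) * L).
    apply/funext => n; rewrite /lagconv/= [X in _ - L - X](eq_bigr
      (fun j => q j * v (n - j.+1)%N - q j * L)).
      by rewrite sumrB -mulr_suml /series/=; ring.
    by move=> j _; rewrite mulrBr.
  rewrite -[0](addr0 0); apply: cvgD => //.
  rewrite -[X in _ --> X](mul0r L); apply: cvgMr_tmp.
  by rewrite -(subrr (1:R)); apply: cvgB => //; exact: cvg_cst.
- by move=> f /vtop [M HM]; exists M => n /HM; lra.
- by move=> f M /(vfreq f M) [n Mn vn]; exists n => //; lra.
- by exists n => // k /Hn; lra.
Qed.

(** If b is the law of the first renewal, then u n is the probability of a renewal at
    time n and 1 - series q k the probability that a block is longer than k: the
    identity splits the event of a past renewal according to the last one. *)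
Lemma renewal_conserved q b u n :
  (forall n, u n = b n + lagconv q u n) ->
  \sum_(0 <= k < n) (1 - series q k) * u (n - k.+1)%N = series b n.
Proof.
move=> urec; elim: n => [|n IH]; first by rewrite /series/= !big_geq.
rewrite seriesSr -IH big_nat_recl//= {1}urec {1}/series/= big_geq// subr0 mul1r.
rewrite subSS subn0 -addrA [RHS]addrC; congr (_ + _).
rewrite /lagconv -big_split/=; apply: eq_big_nat => k /andP[_ kn].
by rewrite subSS seriesSr -mulrDl; congr (_ * _); ring.
Qed.

(** On a long window where u is almost equal to its limsup L, the conserved
    quantity forces M * L <= B; on a long window where it is almost equal to its
    liminf, it forces B <= M * liminf.  So both limits are B / M. *)
Theorem renewal q b u (B M : R) :
  (forall j, 0 <= q j) -> series q @ \oo --> (1 : R) ->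
  is_gcd [set j.+1 | j in [set j | 0 < q j]] 1 ->
  (forall n, 0 <= b n) -> series b @ \oo --> B ->
  (forall n, u n = b n + lagconv q u n) ->
  series (fun k => 1 - series q k) @ \oo --> M ->
  u @ \oo --> B / M.
Proof.
move=> q0 q1 gcdq b0 bB urec rM.
have qle n := series_le_lim q0 q1 n.
have ble n := series_le_lim b0 bB n.
have r0 k : 0 <= 1 - series q k by rewrite subr_ge0.
have rle n := series_le_lim r0 rM n.
have M0 : 0 < M.
  by apply: lt_le_trans ltr01 _; have := rle 1%N; rewrite /series/= big_nat1 big_geq// subr0.
have u0 n : 0 <= u n.
  elim/ltn_ind: n => n IH; rewrite urec addr_ge0// /lagconv big_nat.
  apply: sumr_ge0 => j /andP[_ jn]; rewrite mulr_ge0// IH//; lia.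
have conserved n : \sum_(0 <= k < n.+1) (1 - series q k) * u (n - k)%N = series b n.+1.
  by rewrite -(renewal_conserved _ urec).
have uB n : u n <= B.
  apply: le_trans (ble n.+1); rewrite -conserved big_nat_recl//=.
  rewrite {1}/series/= big_geq// subr0 mul1r subn0 lerDl.
  by apply: sumr_ge0 => k _; rewrite mulr_ge0.
have B0 : 0 <= B by apply: le_trans (u0 0%N) (uB 0%N).
have uabs n : `|u n| <= B by rewrite ger0_norm.
have b_cvg0 : b @ \oo --> (0 : R).
  by apply: cvg_series_cvg_0; apply/cvg_ex; exists B.
have [L [Ltop Lfreq]] := limsup_exists uabs.
(* The liminf of u is handled as the limsup l of - u. *)
have uNabs n : `|- u n| <= B by rewrite normrN.
have [l [ltop lfreq]] := limsup_exists uNabs.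
have defu : (fun n => u n - lagconv q u n) = b.
  by apply/funext => n; rewrite {1}urec addrK.
have defNu : (fun n => - u n - lagconv q (fun n => - u n) n) = (fun n => - b n).
  apply/funext => n; rewrite {1}urec /lagconv.
  rewrite [X in _ - X](eq_bigr (fun j => - (q j * u (n - j.+1)%N))).
    by rewrite sumrN; ring.
  by move=> j _; rewrite mulrN.
have rE n : series (fun k => 1 - series q k) n =
  \sum_(0 <= k < n) (1 - series q k) by [].
have window_sum K n (c : R) : (K <= n)%N -> (forall k, (k <= K)%N -> c <= u (n - k)%N) ->
    series (fun k => 1 - series q k) K * c <= B.
  move=> Kn uc; apply: le_trans (ble n.+1).
  rewrite -conserved (big_cat_nat (leq0n _) (leqW Kn))//= -[leLHS]addr0.
  apply: lerD; last by apply: sumr_ge0 => k _; rewrite mulr_ge0.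
  rewrite rE mulr_suml; apply: ler_sum_nat => k /andP[_ kK].
  by rewrite ler_wpM2l// uc// ltnW.
have LM : M * L <= B.
  apply: (ler_cvg_to (cvgMr_tmp rM) (cvg_cst B)); apply: nearW => K.
  apply/ler_addgt0Pr => e e0.
  have [n Kn Hn] := renewal_near_limsup K K q0 q1 gcdq uabs
     ltac:(by rewrite defu) Ltop Lfreq (divr_gt0 e0 M0).
  have := window_sum K n _ Kn Hn; rewrite mulrBr lerBlDr => /le_trans; apply.
  rewrite lerD2l mulrCA -[leRHS]mulr1 (ler_wpM2l (ltW e0))// ler_pdivrMr// mul1r.
  exact: rle.
have lM : B <= M * - l.
  have lim_rest : (fun K => series (fun k => 1 - series q k) K * - l +
      (M - series (fun k => 1 - series q k) K) * B) @ \oo --> M * - l + (M - M) * B.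
    apply: cvgD; first exact: cvgMr_tmp.
    by apply: cvgMr_tmp; apply: cvgB => //; exact: cvg_cst.
  rewrite subrr mul0r addr0 in lim_rest.
  apply: (ler_cvg_to (cvg_cst B) lim_rest); apply: nearW => K.
  apply/ler_addgt0Pr => e e0; pose d := e / (M + 1).
  have d0 : 0 < d by rewrite divr_gt0// addr_gt0.
  have [N HN] := (cvg_epsP _ _).1 bB d d0.
  have [n Kn Hn] := renewal_near_limsup K (K + N) q0 q1 gcdq uNabs
     ltac:(by rewrite defNu -oppr0; exact: cvgN) ltop lfreq d0.
  have : `|series b n.+1 - B| <= d by apply: HN; lia.
  rewrite ler_norml => /andP[+ _].
  have Kn1 : (K <= n.+1)%N by lia.
  rewrite -conserved (big_cat_nat (leq0n _) Kn1)//=.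
  have h1 : \sum_(0 <= k < K) (1 - series q k) * u (n - k)%N <=
      series (fun k => 1 - series q k) K * (- l + d).
    rewrite rE mulr_suml; apply: ler_sum_nat => k /andP[_ kK].
    by rewrite ler_wpM2l//; have := Hn k (ltnW kK); lra.
  have h2 : \sum_(K <= k < n.+1) (1 - series q k) * u (n - k)%N <=
      (M - series (fun k => 1 - series q k) K) * B.
    apply: (@le_trans _ _ (\sum_(K <= k < n.+1) (1 - series q k) * B)).
      by apply: ler_sum => k _; rewrite ler_wpM2l.
    rewrite -mulr_suml ler_wpM2r//; have := rle n.+1.
    by rewrite !rE (big_cat_nat (leq0n _) Kn1)/=; lra.
  have := rle K; have -> : e = M * d + d by rewrite /d; field; lra.
  move: h1 h2; set RK := series _ K; set s1 := \sum_(_ <= _ < _) _.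
  set s2 := \sum_(_ <= _ < _) _ => h1 h2 RM h.
  have : RK * d <= M * d by rewrite ler_wpM2r// ltW.
  move: h1; rewrite mulrDr; lra.
have L_le : L <= B / M by rewrite ler_pdivlMr// mulrC.
have l_le : l <= - (B / M) by rewrite lerNr ler_pdivrMr// mulrC.
apply/cvg_epsP => e e0.
have [N HN] := Ltop e e0; have [N' HN'] := ltop e e0.
exists (N + N')%N => n nN; rewrite ler_norml.
have := HN n ltac:(lia); have := HN' n ltac:(lia).
by move=> *; apply/andP; split; lra.
Qed.
End RenewalTheorem.

(** * The language of the gap shift *)

Section Language.
Variable S : set nat.
Implicit Types (u v w : seq bool) (x : full_shift).

Definition gap_prefix (k : nat) : Prop := exists2 s, S s & (k <= s)%N.

(** A left-to-right reader of words: [after_one k w] accepts w when the last 1 read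
    was followed by k zeros so far, [before_one k w] when k zeros and no 1 have been
    read so far. *)
Fixpoint after_one (k : nat) w : bool :=
  match w with
  | [::] => `[< gap_prefix k >]
  | true :: w' => (k \in S) && after_one 0 w'
  | false :: w' => after_one k.+1 w'
  end.

Fixpoint before_one (k : nat) w : bool :=
  match w with
  | [::] => `[< gap_prefix k >]
  | true :: w' => `[< gap_prefix k >] && after_one 0 w'
  | false :: w' => before_one k.+1 w'
  end.

Lemma occurs_at_cat x i u v :
  occurs_at x i (u ++ v) <-> occurs_at x i u /\ occurs_at x (i + (size u)%:Z) v.
Proof.
split=> [xuv|[xu xv] k].
  split=> k ku.
    by rewrite xuv ?nth_cat ?ku// size_cat ltn_addr.
  by rewrite -addrA -PoszD xuv ?size_cat ?ltn_add2l// nth_cat ltnNge leq_addr/= addKn.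
rewrite size_cat nth_cat; have [ku _|uk kuv] := ltnP k (size u); first exact: xu.
by rewrite -xv ?ltn_subLR// -addrA -PoszD subnKC.
Qed.

Lemma occurs_zeros_gap_prefix x i k : gap_shift S x ->
  occurs_at x i (nseq k false) -> gap_prefix k.
Proof.
move=> Xx x0; apply: contrapT => nogap.
apply: (Xx (nseq k false)); last by exists i.
by right; exists k => // s Ss; rewrite ltnNge; apply/negP => ks; apply: nogap; exists s.
Qed.

Lemma occurs_after_one x i k w : gap_shift S x ->
  occurs_at x i (true :: nseq k false ++ w) -> after_one k w.
Proof.
move=> Xx; elim: w i k => [|[] w IH] i k /=; rewrite -cat_cons.
- rewrite cats0 -cat1s => /occurs_at_cat[_ x0]; apply/asboolP.
  exact: occurs_zeros_gap_prefix x0.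
- move=> x1; have [_ /(IH _ 0%N) ->] := (occurs_at_cat _ _ _ _).1 x1.
  rewrite andbT; apply: mem_set; apply: contrapT => nSk.
  apply: (Xx (true :: rcons (nseq k false) true)); first by left; exists k.
  by move: x1; rewrite -cat_rcons => /occurs_at_cat[? _]; exists i.
- move=> xw; apply: (IH i); rewrite -cat_cons.
  have -> : nseq k.+1 false = rcons (nseq k false) false.
    by rewrite -cats1 -[[:: false]]/(nseq 1 false) -nseqD addn1.
  by rewrite -rcons_cons cat_rcons.
Qed.

Lemma occurs_before_one x i k w : gap_shift S x ->
  occurs_at x i (nseq k false ++ w) -> before_one k w.
Proof.
move=> Xx; elim: w i k => [|[] w IH] i k /=.
- rewrite cats0 => x0; apply/asboolP; exact: occurs_zeros_gap_prefix x0.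
- move=> /occurs_at_cat[x0 x1]; apply/andP; split.
    by apply/asboolP; exact: occurs_zeros_gap_prefix x0.
  exact: (@occurs_after_one x (i + (size (nseq k false))%:Z) 0).
- move=> xw; apply: (IH i).
  have -> : nseq k.+1 false = rcons (nseq k false) false.
    by rewrite -cats1 -[[:: false]]/(nseq 1 false) -nseqD addn1.
  by rewrite cat_rcons.
Qed.

Lemma after_one_gap_prefix k w : after_one k w -> gap_prefix k.
Proof.
elim: w k => [|[] w IH] k /=; first by move=> /asboolP.
  by move=> /andP[/set_mem Sk _]; exists k.
by move=> /IH[s Ss ks]; exists s => //; exact: ltnW.
Qed.

Lemma after_one_prefix k u v : after_one k (u ++ v) -> after_one k u.
Proof.
elim: u k => [|[] u IH] k /=.
- by move=> /after_one_gap_prefix ?; apply/asboolP.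
- by move=> /andP[-> /IH].
- exact: IH.
Qed.

Lemma after_one_cat_true k u v :
  after_one k (u ++ true :: v) = after_one k (rcons u true) && after_one 0 v.
Proof.
elim: u k => [|[] u IH] k //=; last by rewrite IH andbA.
case: (boolP (k \in S)) => //= /set_mem Sk.
case: (boolP (after_one 0 v)) => [/after_one_gap_prefix ?|_]; last by rewrite andbF.
by rewrite andbT; apply/esym/asboolP.
Qed.

Lemma after_one_nseq k m w :
  after_one k (nseq m false ++ w) = after_one (k + m) w.
Proof. by elim: m k => [|m IH] k /=; rewrite ?addn0// IH addnS addSn. Qed.

Lemma after_one_closes k w :
  after_one k w -> exists m, after_one k (w ++ rcons (nseq m false) true).
Proof.
elim: w k => [|[] w IH] k /=.
- move=> /asboolP[s Ss ks]; exists (s - k)%N.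
  rewrite -cats1 after_one_nseq subnKC//= mem_set//=.
  by apply/asboolP; exists s.
- by move=> /andP[-> /IH].
- exact: IH.
Qed.

(** Every admissible word becomes one that may follow a 1 after some zeros are put
    in front of it: the initial run of zeros is completed to a full gap. *)
Lemma before_one_after_one k w :
  before_one k w -> exists2 j, (k <= j)%N & after_one j w.
Proof.
elim: w k => [|[] w IH] k /=.
- by move=> ?; exists k.
- move=> /andP[/asboolP[s Ss ks] w0]; exists s => //.
  by rewrite mem_set.
- move=> /IH[[//|j] kj wj]; by exists j.
Qed.

Definition periodic_point w : full_shift :=
  fun i => nth false w `|(i %% (size w)%:Z)%Z|%N.

(** After the final 1 of a period, the reader is back in its initial state. *)
Lemma after_one_periodic w L : after_one 0 (rcons w true) ->
  after_one 0 (mkseq (fun l => nth false (rcons w true) (l %% (size w).+1)) L).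
Proof.
set P := rcons w true => okP; elim/ltn_ind: L => L IH.
have sP : size P = (size w).+1 by rewrite size_rcons.
have [LP|PL] := leqP L (size w).+1.
  have -> : mkseq (fun l => nth false P (l %% (size w).+1)) L = take L P.
    apply: (@eq_from_nth _ false) => [|l]; rewrite size_mkseq ?size_takel ?sP//.
    move=> lL; rewrite nth_mkseq// nth_take// modn_small//.
    exact: leq_trans LP.
  by apply: (@after_one_prefix _ _ (drop L P)); rewrite cat_take_drop.
have -> : mkseq (fun l => nth false P (l %% (size w).+1)) L =
    P ++ mkseq (fun l => nth false P (l %% (size w).+1)) (L - (size w).+1).
  apply: (@eq_from_nth _ false) => [|l].
    by rewrite size_cat !size_mkseq sP subnKC// ltnW.
  rewrite size_mkseq => lL; rewrite nth_mkseq// nth_cat sP.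
  case: ltnP => lw; first by rewrite modn_small.
  by rewrite nth_mkseq ?ltn_sub2r// -{1}(subnKC lw) modnDl.
by rewrite /P cat_rcons after_one_cat_true -/P okP IH// ltn_subrL (leq_trans _ PL).
Qed.

(** A forbidden word occurring in the periodic point occurs, up to a translation
    by a multiple of the period, in a word that follows a 1; the reader rejects
    such words. *)
Lemma periodic_point_gap w : after_one 0 (rcons w true) ->
  gap_shift S (periodic_point (rcons w true)).
Proof.
move=> okP v Fv [i xv].
pose P := rcons w true; pose l := `|(i %% (size P)%:Z)%Z|%N.
have sP : size P = (size w).+1 by rewrite size_rcons.
have split_word : mkseq (fun l => nth false P (l %% (size w).+1)) (l + size v) =
    mkseq (fun l => nth false P (l %% (size w).+1)) l ++ v.
  apply: (@eq_from_nth _ false) => [|k].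
    by rewrite size_cat !size_mkseq.
  rewrite size_mkseq => klv; rewrite nth_mkseq// nth_cat size_mkseq.
  case: ltnP => kl; first by rewrite nth_mkseq.
  rewrite -xv ?ltn_subLR// /periodic_point -/P sP; congr nth.
  have -> : i + (k - l)%N%:Z = (k%:Z + (i %/ (size P)%:Z)%Z * (size P)%:Z).
    rewrite {1}(divz_eq i (size P)%:Z) -/l -subzn//.
    have -> : (i %% size P)%Z = l%:Z by rewrite /l gez0_abs// modz_ge0// sP.
    by ring.
  by rewrite sP addrC modzMDl modz_nat.
have := after_one_periodic (l + size v) okP; rewrite split_word.
case: Fv => [[n nSn ->]|[n nS ->]].
  rewrite after_one_cat_true => /andP[_].
  by rewrite -cats1 after_one_nseq/= add0n => /andP[/set_mem].
have : forall k u, after_one k (u ++ nseq n false) -> exists2 s, S s & (n <= s)%N.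
  move=> k u; elim: u k => [|[] u IH] k /=.
  - by rewrite -[nseq _ _]cats0 after_one_nseq/= => /asboolP[s Ss ks]; exists s => //; lia.
  - by move=> /andP[_ /IH].
  - exact: IH.
by move=> h /h[s /nS]; rewrite ltnNge => /negP.
Qed.

(** An accepted word extends on both sides to a concatenation of full gaps, each
    closed by a 1; repeating the latter periodically gives a point of the shift. *)
Lemma in_languageP w :
  in_language (gap_shift S) w <-> before_one 0 w.
Proof.
split=> [[x Xx [i xw]]|/before_one_after_one[j _ wj]].
  exact: (@occurs_before_one x i 0).
have [m wm] := after_one_closes wj.
rewrite -rcons_cat -[j]add0n -after_one_nseq -rcons_cat in wm.
exists (periodic_point (rcons (nseq j false ++ w ++ nseq m false) true)).
  exact: periodic_point_gap.
exists j%:Z => k kw; rewrite /periodic_point -PoszD modz_nat absz_nat.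
rewrite modn_small; last by rewrite size_rcons !size_cat size_nseq; lia.
rewrite rcons_cat nth_cat size_nseq ltnNge leq_addr/= addKn rcons_cat nth_cat kw.
by [].
Qed.

End Language.

(** * Weighted counting of words *)

Section Counting.
Variables (R : realType) (S : set nat).
Implicit Types (c z : R) (ok : seq bool -> bool) (k n : nat).

Lemma sum_tuple_bool_cons n (F : seq bool -> R) :
  \sum_(w : n.+1.-tuple bool) F w =
  \sum_(w : n.-tuple bool) F (true :: w) + \sum_(w : n.-tuple bool) F (false :: w).
Proof.
rewrite (reindex (fun p : bool * n.-tuple bool => cons_tuple p.1 p.2)) /=.
  by rewrite -(pair_bigA _ (fun b (w : n.-tuple bool) => F (b :: w))) big_bool.
exists (fun w : n.+1.-tuple bool => (thead w, behead_tuple w)) => [[b w] _|w _] /=.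
  by congr (_, _); apply/val_inj.
by rewrite [RHS]tuple_eta; exact/val_inj.
Qed.

Definition ones_weight c z (w : seq bool) : R := c ^+ count id w * z ^+ size w.

Definition partition_sum ok c z n : R :=
  \sum_(w : n.-tuple bool) (ok w)%:R * ones_weight c z w.

Definition gap_ind k : R := (k \in S)%:R.
Definition prefix_ind k : R := `[< gap_prefix S k >]%:R.

(** Unfolding a one-letter recursion along the initial run of zeros: j is the
    length of this run, and the reader is in state 0 after the 1 that ends it. *)
Let cons_recursion (F : nat -> nat -> R) (e g : nat -> R) z V :
  (forall k, F k 0%N = e k) ->
  (forall k n, F k n.+1 = g k * z * V n + z * F k.+1 n) ->
  forall k n, F k n = e (k + n)%N * z ^+ n +
    \sum_(0 <= j < n) g (k + j)%N * z ^+ j.+1 * V (n - j.+1)%N.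
Proof.
move=> F0 FS k n; elim: n k => [|n IH] k.
  by rewrite F0 addn0 expr0 mulr1 big_geq// addr0.
rewrite FS IH big_nat_recl//= addn0 subn1/= expr1 mulrDr addrCA addSnnS mulr_sumr.
congr (_ + (_ + _)); first by rewrite exprS mulrCA.
by apply: eq_bigr => j _; rewrite addSnnS subSS [z ^+ j.+2]exprS; ring.
Qed.

Lemma partition_sum_cons ok c z n :
  partition_sum ok c z n.+1 =
  c * z * partition_sum (fun w => ok (true :: w)) c z n +
  z * partition_sum (fun w => ok (false :: w)) c z n.
Proof.
rewrite /partition_sum (sum_tuple_bool_cons n (fun w => (ok w)%:R * ones_weight c z w)).
rewrite !mulr_sumr; congr (_ + _); apply: eq_bigr => w _.
  by rewrite /ones_weight /= add1n !exprS; ring.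
by rewrite /ones_weight /= add0n !exprS; ring.
Qed.

Lemma partition_sum_cond (b : bool) ok c z n :
  partition_sum (fun w => b && ok w) c z n = b%:R * partition_sum ok c z n.
Proof.
rewrite /partition_sum mulr_sumr; apply: eq_bigr => w _.
by rewrite mulrA -natrM mulnb.
Qed.

Lemma partition_sum_nil ok c z : partition_sum ok c z 0 = (ok [::])%:R.
Proof.
rewrite /partition_sum (bigD1 [tuple])//= big1.
  by rewrite addr0 /ones_weight/= !expr0 !mulr1.
by move=> w /eqP[]; exact: tuple0.
Qed.

Lemma after_one_sum c z n :
  partition_sum (after_one S 0) c z n = prefix_ind n * z ^+ n +
  lagconv (fun j => c * gap_ind j * z ^+ j.+1) (partition_sum (after_one S 0) c z) n.
Proof.
have := @cons_recursion (fun k n => partition_sum (after_one S k) c z n) prefix_ind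
  (fun j => c * gap_ind j) z (partition_sum (after_one S 0) c z).
move=> /(_ _ _ 0%N n) -> //.
- by move=> k; rewrite partition_sum_nil.
- by move=> k m; rewrite partition_sum_cons/= partition_sum_cond /gap_ind; ring.
Qed.

Lemma before_one_sum c z n :
  partition_sum (before_one S 0) c z n = prefix_ind n * z ^+ n +
  lagconv (fun j => c * prefix_ind j * z ^+ j.+1) (partition_sum (after_one S 0) c z) n.
Proof.
have := @cons_recursion (fun k n => partition_sum (before_one S k) c z n) prefix_ind
  (fun j => c * prefix_ind j) z (partition_sum (after_one S 0) c z).
move=> /(_ _ _ 0%N n) -> //.
- by move=> k; rewrite partition_sum_nil.
- by move=> k m; rewrite partition_sum_cons/= partition_sum_cond /prefix_ind; ring.
Qed.

Lemma complexity_sum z n :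
  (complexity (gap_shift S) n)%:R * z ^+ n = partition_sum (before_one S 0) 1 z n.
Proof.
rewrite /complexity -sum1_card natr_sum mulr_suml big_mkcond/=.
apply: eq_bigr => w _; rewrite inE /ones_weight expr1n mul1r size_tuple.
have -> : `[< in_language (gap_shift S) w >] = before_one S 0 w.
  by apply/asboolP/idP => /in_languageP.
by case: ifP; rewrite ?mul0r ?mul1r.
Qed.

Lemma partition_sum_ge0 ok c z n : 0 <= c -> 0 <= z -> 0 <= partition_sum ok c z n.
Proof.
by move=> c0 z0; apply: sumr_ge0 => w _; rewrite !mulr_ge0 ?exprn_ge0.
Qed.

Lemma sum_expr_le z n : 0 < z < 1 -> \sum_(0 <= i < n) z ^+ i <= (1 - z)^-1.
Proof.
move=> /andP[z0 z1].
have := @geometric_le_lim R n 1 z ler01 z0.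
rewrite (ger0_norm (ltW z0)) => /(_ z1); rewrite mul1r; apply: le_trans.
by rewrite /series/= le_eqVlt; apply/orP; left; apply/eqP/eq_bigr => i _; rewrite mul1r.
Qed.

(** The partition sum solves a renewal equation with a sub-probability kernel and
    a source term at most z ^ n, so that it is at most the sum of the sources. *)
Lemma after_one_sum_le c z n : 0 <= c -> 0 < z < 1 ->
  (forall n, series (fun j => c * gap_ind j * z ^+ j.+1) n <= 1) ->
  partition_sum (after_one S 0) c z n <= \sum_(0 <= i < n.+1) z ^+ i.
Proof.
move=> c0 z01 q1; have z0 : 0 <= z by case/andP: z01 => /ltW.
have w0 j : 0 <= c * gap_ind j * z ^+ j.+1 by rewrite !mulr_ge0 ?exprn_ge0.
elim/ltn_ind: n => n IH.
rewrite after_one_sum big_nat_recr//= [leLHS]addrC lerD//.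
  apply: (@le_trans _ _ (\sum_(0 <= j < n) c * gap_ind j * z ^+ j.+1 * \sum_(0 <= i < n) z ^+ i)).
    rewrite /lagconv; apply: ler_sum_nat => j /andP[_ jn]; apply: ler_wpM2l => //.
    apply: le_trans (IH _ _) _; first by lia.
    have -> : ((n - j.+1).+1 = n - j)%N by lia.
    exact: (@series_ge0_homo R (fun i => z ^+ i) (fun i => exprn_ge0 i z0) _ _ (leq_subr j n)).
  rewrite -mulr_suml; apply: ler_piMl; last exact: q1.
  by apply: sumr_ge0 => i _; exact: exprn_ge0.
by apply: ler_piMl; rewrite ?exprn_ge0// lern1 leq_b1.
Qed.

Lemma before_one_sum_bounded c z : 0 <= c -> 0 < z < 1 ->
  (forall n, series (fun j => c * gap_ind j * z ^+ j.+1) n <= 1) ->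
  exists D, forall n, partition_sum (before_one S 0) c z n <= D.
Proof.
move=> c0 z01 q1; have z0 : 0 <= z by case/andP: z01 => /ltW.
have z1 : z <= 1 by case/andP: z01 => _ /ltW.
pose G := (1 - z)^-1; exists (1 + c * z * G * G) => n.
have G0 : 0 <= G by rewrite invr_ge0 subr_ge0.
rewrite before_one_sum lerD//.
  apply: (@le_trans _ _ (1 * 1)); last by rewrite mul1r.
  by apply: ler_pM; rewrite ?exprn_ge0// ?lern1 ?leq_b1// exprn_ile1.
apply: (@le_trans _ _ (\sum_(0 <= j < n) c * z * G * z ^+ j)).
  rewrite /lagconv; apply: ler_sum => j _.
  have -> : c * z * G * z ^+ j = (c * 1 * z ^+ j.+1) * G by rewrite exprS; ring.
  apply: ler_pM.
  - by rewrite !mulr_ge0 ?exprn_ge0.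
  - exact: partition_sum_ge0.
  - by rewrite ler_wpM2r ?exprn_ge0// ler_wpM2l// lern1 leq_b1.
  - by apply: le_trans (after_one_sum_le _ c0 z01 q1) _; exact: sum_expr_le.
by rewrite -mulr_sumr ler_wpM2l ?mulr_ge0//; exact: sum_expr_le.
Qed.

End Counting.

(** * The root x and the tails of the gap distribution *)

Section Root.
Variables (R : realType).

Lemma le1_of_scaled (a : R) n :
  (forall y, 0 < y -> y < 1 -> a * y ^+ n <= 1) -> a <= 1.
Proof.
move=> ay.
have cvga : a * y ^+ n @[y --> 1^'-] --> a * 1 ^+ n.
  by apply: cvg_at_left_filter; apply: cvgMl_tmp; exact: exprn_continuous.
rewrite expr1n mulr1 in cvga.
apply: (ler_cvg_to cvga (cvg_cst (1 : R))).
near=> y; apply: ay.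
  by near: y; exact: nbhs_left_gt.
by near: y; exact: nbhs_left_lt.
Unshelve. all: by end_near. Qed.

Lemma ge1_of_scaled (a d y0 : R) n : 1 < y0 ->
  (forall y, 1 < y -> y < y0 -> 1 <= y * (a * y ^+ n + d)) -> 1 <= a + d.
Proof.
move=> y01 ay.
have cvga : y * (a * y ^+ n + d) @[y --> 1^'+] --> 1 * (a * 1 ^+ n + d).
  apply: cvg_at_right_filter; apply: cvgM; first exact: cvg_id.
  by apply: cvgD; [apply: cvgMl_tmp; exact: exprn_continuous|exact: cvg_cst].
rewrite expr1n mulr1 mul1r in cvga.
apply: (ler_cvg_to (cvg_cst (1 : R)) cvga).
near=> y; apply: ay.
  by near: y; exact: nbhs_right_gt.
by near: y; exact: nbhs_right_lt.
Unshelve. all: by end_near. Qed.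

(** Summation by parts; for Q the total mass of q, it says that the generating
    function of q has first-order expansion Q + (y - 1) * M at y = 1, where M is the
    sum of the tails Q - series q k. *)
Lemma series_scaled (q : nat -> R) (Q y : R) n :
  series (fun j => q j * y ^+ j.+1) n = Q - (Q - series q n) * y ^+ n +
    (y - 1) * \sum_(0 <= k < n) (Q - series q k) * y ^+ k.
Proof.
elim: n => [|n IH]; first by rewrite /series/= !big_geq// expr0; ring.
rewrite seriesSr IH big_nat_recr//= [in series q n.+1]seriesSr exprS; ring.
Qed.

Lemma series_bounded_cvg (a : nat -> R) C : (forall n, 0 <= a n) ->
  (forall n, series a n <= C) -> exists2 l, series a @ \oo --> l & l <= C.
Proof.
move=> a0 aC.
have := nondecreasing_cvgn (@series_ge0_homo R a a0) _.
move=> /(_ (ex_intro _ C _)) al.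
have {}al := al (fun _ => ltac:(by move=> [n _ <-])).
exists (sup (range (series a))) => //.
by apply: (ler_cvg_to al (cvg_cst C)); exact: nearW.
Qed.

Lemma sum_bounded_weight (g : nat -> R) (x : R) : (forall j, g j <= 1) ->
  0 < x < 1 -> forall k m, (k <= m)%N ->
  series (fun j => g j * x ^+ j.+1) m <= series (fun j => g j * x ^+ j.+1) k + x ^+ k.+1 / (1 - x).
Proof.
move=> g1 /andP[x0 x1] k m km.
have x1' : 0 < 1 - x by rewrite subr_gt0.
apply: (@le_trans _ _ (series (fun j => g j * x ^+ j.+1) m + x ^+ m.+1 / (1 - x))).
  by rewrite lerDl divr_ge0// ?exprn_ge0 ?ltW.
rewrite -(subnKC km); elim: (m - k)%N => [|i IH]; first by rewrite addn0.
apply: le_trans IH; rewrite addnS seriesSr -addrA lerD2l.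
have -> : x ^+ (k + i).+1 / (1 - x) = x ^+ (k + i).+1 + x ^+ (k + i).+2 / (1 - x).
  by rewrite [x ^+ (k + i).+2]exprS; field; rewrite gt_eqF.
by rewrite lerD2r ler_piMl// exprn_ge0// ltW.
Qed.

(** Since x < 1 and the coefficients are at most 1, the tails of the gap
    distribution decay like x ^ k and survive the factor y ^ k for y < x^-1. *)
Lemma sum_tail_le (g : nat -> R) (x y Q : R) : (forall j, g j <= 1) ->
  0 < x < 1 -> 0 < y -> x * y < 1 -> (forall j, 0 <= g j) ->
  series (fun j => g j * x ^+ j.+1) @ \oo --> Q -> forall K n,
  \sum_(K <= k < n) (Q - series (fun j => g j * x ^+ j.+1) k) * y ^+ k <=
   x / (1 - x) * ((x * y) ^+ K / (1 - x * y)).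
Proof.
move=> g1 /andP[x0 x1] y0 xy1 g0 gQ K n.
have xy0 : 0 < x * y by rewrite mulr_gt0.
have x1' : 0 < 1 - x by rewrite subr_gt0.
have xy1' : 0 < 1 - x * y by rewrite subr_gt0.
have tail k : Q - series (fun j => g j * x ^+ j.+1) k <= x ^+ k.+1 / (1 - x).
  rewrite lerBlDl; apply: (ler_cvg_to gQ (cvg_cst _)).
  exists k => // m /= km; apply: sum_bounded_weight => //; exact/andP.
have [Kn|nK] := leqP K n; last first.
  rewrite big_geq ?(ltnW nK)// mulr_ge0// divr_ge0 ?exprn_ge0//; exact: ltW.
apply: (@le_trans _ _ (\sum_(K <= k < n) x / (1 - x) * (x * y) ^+ k)).
  apply: ler_sum => k _.
  have -> : x / (1 - x) * (x * y) ^+ k = x ^+ k.+1 / (1 - x) * y ^+ k.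
    by rewrite exprMn exprS; ring.
  by apply: ler_wpM2r; rewrite ?exprn_ge0// ltW.
rewrite -mulr_sumr; apply: ler_wpM2l; first by rewrite divr_ge0 ?ltW.
rewrite -(subnKC Kn) geometric_partial_tail.
by apply: geometric_le_lim; rewrite ?exprn_ge0 ?(ltW xy0)// ger0_norm// ltW.
Qed.

Lemma exists_gt1_mul_lt1 (x : R) : 0 < x -> x < 1 -> exists2 y, 1 < y & x * y < 1.
Proof.
move=> x0 x1; have xi : 1 < x^-1 by rewrite invf_gt1.
exists ((1 + x^-1) / 2); first by lra.
by rewrite mulrA mulrDr mulfV ?gt_eqF//; lra.
Qed.

(** The supremum x of the z at which the series is at most 1.  If the total mass at x
    were less than 1, the expansion of [series_scaled] at a ratio y slightly above 1
    would keep it below 1 at x * y, contradicting the choice of x. *)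
Lemma root_exists (g : nat -> R) : (forall j, 0 <= g j) -> (forall j, g j <= 1) ->
  (exists n, 1 < series g n) ->
  exists2 x : R, 0 < x < 1 & series (fun j => g j * x ^+ j.+1) @ \oo --> (1 : R).
Proof.
move=> g0 g1 [N gN].
pose f z := series (fun j => g j * z ^+ j.+1).
pose E := [set z : R | [/\ 0 <= z, z <= 1 & forall n, f z n <= 1]].
have Ehalf : E (2^-1).
  split; [by lra|by lra|] => n.
  have := @sum_bounded_weight g 2^-1 g1 ltac:(lra) 0 n (leq0n n).
  rewrite {2}/series/= big_geq// add0r expr1 -/(f _ n) => /le_trans; apply.
  by rewrite ler_pdivrMr; lra.
have supE : has_sup E by split; [exists 2^-1|exists 1 => z []].
pose x := sup E.
have xhalf : 2^-1 <= x by exact: sup_upper_bound.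
have x0 : 0 < x by lra.
have q0 z j : 0 <= z -> 0 <= g j * z ^+ j.+1 by move=> z0; rewrite mulr_ge0// exprn_ge0.
have below z : 0 <= z -> z < x -> forall n, f z n <= 1.
  move=> z0 zx n; have xz0 : 0 < x - z by rewrite subr_gt0.
  have [w [w0 w1 wE] zw] := sup_adherent xz0 supE.
  apply: le_trans (wE n); apply: ler_sum => j _; apply: ler_wpM2l => //.
  apply: lerXn2r; rewrite ?nnegrE//; rewrite -/x in zw; lra.
have fx1 n : f x n <= 1.
  apply: (@le1_of_scaled _ n) => y y0 y1.
  apply: le_trans (below (x * y) _ _ n); last 2 first.
  - by rewrite mulr_ge0// ltW.
  - by rewrite gtr_pMr.
  rewrite /f /series/= mulr_suml; apply: ler_sum_nat => j /andP[_ jn].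
  rewrite exprMn -mulrA; apply: ler_wpM2l => //; apply: ler_wpM2l.
    by rewrite exprn_ge0// ltW.
  by apply: ler_wiXn2l => //; exact: ltW.
have x1 : x < 1.
  rewrite lt_neqAle; apply/andP; split; last by apply: sup_le_ub => [|z []//]; exists 2^-1.
  apply/negP => /eqP x1; have := fx1 N; rewrite x1 leNgt /f => /negP; apply.
  apply: lt_le_trans gN _; rewrite le_eqVlt; apply/orP; left; apply/eqP.
  by apply: eq_bigr => j _; rewrite expr1n mulr1.
have [Q fQ Q1] := series_bounded_cvg (fun j => q0 x j (ltW x0)) fx1.
exists x; first exact/andP.
suff -> : 1 = Q by [].
apply/eqP; rewrite eq_le Q1 andbT leNgt; apply/negP => Qlt1.
have [y0 y01 xy0] := exists_gt1_mul_lt1 x0 x1.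
pose A := x / (1 - x) * ((x * y0) ^+ 0 / (1 - x * y0)).
have A0 : 0 < A.
  by rewrite /A mulr_gt0 ?divr_gt0 ?subr_gt0// expr0.
have dA : 0 < (1 - Q) / A by rewrite divr_gt0// subr_gt0.
pose y := Num.min y0 (1 + (1 - Q) / A).
have y1 : 1 < y by rewrite lt_min y01/= ltrDl.
have yy0 : y <= y0 by rewrite ge_min lexx.
have yA : (y - 1) * A <= 1 - Q.
  rewrite -ler_pdivlMr// lerBlDl; by rewrite ge_min lexx orbT.
have xy1 : x * y < 1 by apply: le_lt_trans xy0; rewrite ler_pM2l.
have : E (x * y).
  split; [by rewrite mulr_ge0//; lra|exact: ltW|] => n.
  have -> : f (x * y) n = series (fun j => g j * x ^+ j.+1 * y ^+ j.+1) n.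
    by apply: eq_bigr => j _; rewrite exprMn mulrA.
  rewrite (series_scaled _ Q).
  have r0 k : 0 <= Q - f x k.
    by rewrite subr_ge0; apply: (series_le_lim (fun j => q0 x j (ltW x0)) fQ).
  have h1 : 0 <= (Q - f x n) * y ^+ n by rewrite mulr_ge0// exprn_ge0//; lra.
  have h2 : \sum_(0 <= k < n) (Q - f x k) * y ^+ k <= A.
    apply: le_trans (sum_tail_le g1 _ _ xy0 g0 fQ 0 n); last 2 first.
    - exact/andP.
    - by lra.
    apply: ler_sum => k _; apply: ler_wpM2l => //.
    by apply: lerXn2r; rewrite ?nnegrE//; lra.
  have : (y - 1) * \sum_(0 <= k < n) (Q - f x k) * y ^+ k <= (y - 1) * A.
    by rewrite ler_pM2l// subr_gt0.
  by move: h1; rewrite /f; lra.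
move=> /(sup_upper_bound supE); rewrite -/x leNgt => /negP; apply.
by rewrite ltr_pMr.
Qed.
End Root.

(** * Measures and entropy *)

Section Measure.
Variable R : realType.

Lemma open_coord (i : int) (b : bool) : open [set x : full_shift | x i = b].
Proof.
have coord_cont : continuous ((fun x => x i) : full_shift -> bool).
  exact: (@proj_continuous int (fun _ => bool) i).
have H := (continuousP _).1 coord_cont.
by apply: (H [set b]); exact: discrete_open.
Qed.

Lemma occurs_at_cons (x : full_shift) i b w :
  occurs_at x i (b :: w) <-> x i = b /\ occurs_at x (i + 1) w.
Proof.
rewrite -cat1s occurs_at_cat/=; split=> -[xb xw]; split=> //.
  by have := xb 0%N isT; rewrite addr0.
by move=> [|//] _; rewrite addr0.
Qed.

Lemma open_occurs_at i w : open [set x : full_shift | occurs_at x i w].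
Proof.
elim: w i => [|b w IH] i.
  have -> : [set x : full_shift | occurs_at x i [::]] = setT by apply/seteqP; split.
  exact: openT.
have -> : [set x : full_shift | occurs_at x i (b :: w)] =
    [set x : full_shift | x i = b] `&` [set x : full_shift | occurs_at x (i + 1) w].
  by apply/seteqP; split => x /= /occurs_at_cons.
by apply: openI; [exact: open_coord|exact: IH].
Qed.

Lemma open_measurable_shift (U : set full_shift) :
  open U -> measurable (U : set borel_full_shift).
Proof. by move=> oU; apply: sub_sigma_algebra. Qed.

Lemma measurable_avoiding F : measurable (avoiding F : set borel_full_shift).
Proof.
rewrite -[avoiding F]setCK; apply: measurableC; apply: open_measurable_shift.
have -> : ~` avoiding F =
    \bigcup_(w in F) \bigcup_(i in @setT int) [set x : full_shift | occurs_at x i w].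
  apply/seteqP; split => x /=.
    move=> nx; apply: contrapT => xF; apply: nx => w Fw [i xw].
    by apply: xF; exists w => //; exists i.
  by move=> [w Fw [i _ xw]] Xx; apply: (Xx w Fw); exists i.
by apply: bigcup_open => w _; apply: bigcup_open => i _; exact: open_occurs_at.
Qed.

(** Nonnegativity of the relative entropy with respect to the weights a normalised
    to a probability, from ln (1 + t) <= t. *)
Lemma gibbs (I : finType) (m a : I -> R) (D : R) :
  0 < D -> \sum_i a i <= D -> \sum_i m i = 1 ->
  (forall i, 0 <= m i) -> (forall i, 0 <= a i) -> (forall i, 0 < m i -> 0 < a i) ->
  \sum_i - (m i * ln (m i)) <= ln D - \sum_i m i * ln (a i).
Proof.
move=> D0 aD m1 m0 a0 ma.
have pointwise i : m i * ln (a i) - m i * ln (m i) - m i * ln D <= a i / D - m i.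
  have := m0 i; rewrite le_eqVlt => /predU1P[<-|mi].
    by rewrite !mul0r !subr0 divr_ge0// ltW.
  have ai := ma i mi.
  rewrite -!mulrBr -!ln_div ?posrE ?divr_gt0//.
  have -> : a i / D - m i = m i * (a i / m i / D - 1).
    by field; rewrite !gt_eqF.
  rewrite ler_pM2l//.
  have /le_ln1Dx : -1 < a i / m i / D - 1.
    by rewrite ltrBDl subrr !divr_gt0.
  by rewrite addrC subrK.
have : \sum_i (m i * ln (a i) - m i * ln (m i) - m i * ln D) <= \sum_i (a i / D - m i).
  exact: ler_sum.
rewrite !big_split/= !sumrN -!mulr_suml m1 mul1r.
have : (\sum_i a i) / D <= 1 by rewrite ler_pdivrMr// mul1r.
by lra.
Qed.

Variable mu : probability borel_full_shift R.
Implicit Types (B : set borel_full_shift) (i : int) (n : nat).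

Local Notation mass B := (fine (mu B)).
Local Notation occ i w := [set x : borel_full_shift | occurs_at (x : full_shift) i w].
Local Notation coord i b := [set x : borel_full_shift | (x : full_shift) i = b].

Lemma measurable_coord i b : measurable (coord i b).
Proof. by apply: open_measurable_shift; exact: open_coord. Qed.

Lemma mass_coord_split i B : measurable B ->
  mass (B `&` coord i true) + mass (B `&` coord i false) = mass B.
Proof.
move=> mB; have mT := measurable_coord i true; have mF := measurable_coord i false.
rewrite -fineD ?fin_num_measure//; try exact: measurableI.
rewrite -measureU; last first.
- by apply/seteqP; split => x //= [[_ ->] []].
- exact: measurableI.
- exact: measurableI.
congr (fine (mu _)); rewrite -setIUr setIidl// => x _ /=.
by case: (x i); [left|right].
Qed.

Lemma occ_cons i b w B :
  B `&` occ i (b :: w) = B `&` coord i b `&` occ (i + 1) w.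
Proof.
rewrite -setIA; congr setI.
by apply/seteqP; split => x /= /occurs_at_cons.
Qed.

Lemma sum_mass_occ i B n : measurable B ->
  \sum_(w : n.-tuple bool) mass (B `&` occ i w) = mass B.
Proof.
elim: n i B => [|n IH] i B mB.
  rewrite (bigD1 [tuple])//= big1; last by move=> w /eqP[]; exact: tuple0.
  by rewrite addr0; congr (fine (mu _)); apply/seteqP; split => x //= [].
rewrite (sum_tuple_bool_cons n (fun w => mass (B `&` occ i w))) -(mass_coord_split i mB).
by congr (_ + _); under eq_bigr do rewrite occ_cons;
  apply: IH; apply: measurableI => //; exact: measurable_coord.
Qed.

Lemma sum_mass_count i B n : measurable B ->
  \sum_(w : n.-tuple bool) mass (B `&` occ i w) * (count id w)%:R =
  \sum_(0 <= k < n) mass (B `&` coord (i + k%:Z) true).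
Proof.
elim: n i B => [|n IH] i B mB.
  by rewrite big_geq// big1// => w _; rewrite tuple0/= mulr0.
have mT : measurable (B `&` coord i true).
  by apply: measurableI => //; exact: measurable_coord.
have mF : measurable (B `&` coord i false).
  by apply: measurableI => //; exact: measurable_coord.
rewrite (sum_tuple_bool_cons n (fun w => mass (B `&` occ i w) * (count id w)%:R)) /=.
rewrite big_nat_recl// addr0.
under eq_bigr do rewrite occ_cons natrD mulrDr mulr1.
rewrite big_split/= sum_mass_occ// -addrA; congr (_ + _).
under [X in _ + X]eq_bigr do rewrite occ_cons add0n.
rewrite !IH// -big_split/=; apply: eq_bigr => k _.
have mk := measurable_coord (i + k.+1%:Z) true.
have -> : i + 1 + k%:Z = i + k.+1%:Z by lia.
rewrite -(mass_coord_split i (measurableI _ _ mB mk)).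
by congr (mass _ + mass _); rewrite setIAC.
Qed.

Lemma mass_full X B : measurable X -> measurable B -> mu X = 1%E ->
  mu (X `&` B) = mu B.
Proof.
move=> mX mB X1.
have muCX : mu (~` X) = 0%E by rewrite probability_setC// X1 subee.
have muBX : mu (B `\` X) = 0%E.
  apply: (subset_measure0 _ _ _ muCX).
  - exact: measurableD.
  - exact: measurableC.
  - by move=> x [].
transitivity (mu (B `\` X) + mu (B `&` X))%E; first by rewrite muBX add0e setIC.
by symmetry; exact: measureDI.
Qed.

Lemma mass_coord_shift k : (forall B, measurable B -> mu (Defs.shift @^-1` B) = mu B) ->
  mu (coord k%:Z true) = mu (coord 0 true).
Proof.
move=> inv; elim: k => [//|k IH]; rewrite -IH -(inv _ (measurable_coord k%:Z true)).
by congr (mu _); apply/seteqP; split => x /=; rewrite /Defs.shift -addn1 PoszD.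
Qed.

Variable S : set nat.
Let X : set full_shift := gap_shift S.
Let p : R := word_measure X mu [:: true].

Lemma sum_word_measure n : mu X = 1%E ->
  \sum_(w : n.-tuple bool) word_measure X mu w = 1.
Proof.
by move=> X1; rewrite (sum_mass_occ 0 n (measurable_avoiding _)) X1.
Qed.

Lemma sum_word_measure_count n : invariant_on X mu ->
  \sum_(w : n.-tuple bool) word_measure X mu w * (count id w)%:R = n%:R * p.
Proof.
move=> [X1 inv]; have mX := measurable_avoiding (gap_forbidden S).
rewrite (sum_mass_count 0 n mX).
rewrite (eq_bigr (fun _ => p)) => [|k _].
  by rewrite sumr_const_nat subn0 mulr_natl.
rewrite add0r /p /word_measure mass_full//; last exact: measurable_coord.
rewrite mass_coord_shift// -[in LHS](mass_full mX)//; last exact: measurable_coord.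
congr (mass (_ `&` _)); apply/seteqP; split => x /=.
  by move=> x0; apply/occurs_at_cons; split.
by move=> /occurs_at_cons[].
Qed.

Lemma word_measure_gt0_before_one w : 0 < word_measure X mu w -> before_one S 0 w.
Proof.
move=> w0; apply/in_languageP; apply: contrapT => nw; move: w0.
rewrite /word_measure; have -> : [set x | X x /\ occurs_at x 0 w] = set0.
  by apply/seteqP; split => x //= [Xx xw]; apply: nw; exists x => //; exists 0.
by rewrite measure0 ltxx.
Qed.

(** Gibbs' inequality for the weights z ^ n * c ^ (number of 1s), the total weight
    being bounded in n. *)
Lemma entropy_le (c z : R) : invariant_on X mu -> 0 < entropy X mu ->
  0 < c -> 0 < z < 1 ->
  (forall n, series (fun j => c * gap_ind R S j * z ^+ j.+1) n <= 1) ->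
  entropy X mu <= - ln z - p * ln c.
Proof.
move=> Xinv h0 c0 z01 q1; have z0 : 0 < z by case/andP: z01.
have [D ZD] := before_one_sum_bounded (ltW c0) z01 q1.
pose E := Num.max D 1.
have E0 : 0 < E by rewrite lt_max ltr01 orbT.
pose H n := \sum_(w : n.-tuple bool) - (word_measure X mu w * ln (word_measure X mu w)).
(* The limit of a divergent sequence is 0 by convention, so that positivity of
   the entropy implies convergence of the averages. *)
have cvgH : cvgn (fun n => n%:R^-1 * H n).
  by apply: contrapT => /dvgP ncv; move: h0; rewrite /entropy -/(H _) ncv ltxx.
have HE n : H n <= ln E - n%:R * (ln z + p * ln c).
  have wm0 (w : n.-tuple bool) : 0 <= word_measure X mu w by rewrite fine_ge0.
  have := @gibbs _ (fun w : n.-tuple bool => word_measure X mu w)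
     (fun w => (before_one S 0 w)%:R * ones_weight c z w) E E0 _ (sum_word_measure n Xinv.1) wm0.
  have aw (w : n.-tuple bool) : 0 < ones_weight c z w by rewrite mulr_gt0 ?exprn_gt0.
  move=> /(_ _ _ _)/le_trans; apply.
  - by rewrite (le_trans (ZD n))// le_max lexx.
  - by move=> w; rewrite mulr_ge0// ltW.
  - by move=> w /word_measure_gt0_before_one ->; rewrite mul1r.
  rewrite lerD2l lerN2 (eq_bigr (fun w : n.-tuple bool =>
     word_measure X mu w * (count id w)%:R * ln c + word_measure X mu w * (n%:R * ln z))).
    rewrite big_split/= -!mulr_suml sum_word_measure_count// sum_word_measure; last exact: Xinv.1.
    by rewrite mul1r; lra.
  move=> w _; have := wm0 w; rewrite le_eqVlt => /predU1P[<-|]; first by rewrite !mul0r addr0.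
  move=> /word_measure_gt0_before_one ->; rewrite mul1r /ones_weight.
  by rewrite lnM ?posrE ?exprn_gt0// !lnXn// size_tuple
    -[ln c *+ _]mulr_natl -[ln z *+ _]mulr_natl; ring.
have lim_bound : (fun n => n.+1%:R^-1 * ln E - (ln z + p * ln c)) @ \oo -->
    0 * ln E - (ln z + p * ln c).
  by apply: cvgB; [apply: cvgMr_tmp; exact: cvg_harmonic|exact: cvg_cst].
have {}cvgH : (fun n => n.+1%:R^-1 * H n.+1) @ \oo --> entropy X mu.
  by rewrite (cvg_shiftS (fun n => n%:R^-1 * H n)); exact: cvgH.
have -> : - ln z - p * ln c = 0 * ln E - (ln z + p * ln c) by ring.
apply: (ler_cvg_to cvgH lim_bound); apply: nearW => n /=.
by rewrite ler_pdivrMl ?ltr0n// mulrBr mulrA divff ?pnatr_eq0// mul1r; exact: HE.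
Qed.

End Measure.

(** * Asymptotics and the density of 1s *)

Section Assembly.
Variables (R : realType) (S : set nat).
Hypothesis S_pos : forall s, S s -> (0 < s)%N.
Hypothesis S_gcd : is_gcd [set s.+1 | s in S] 1.

Lemma gap_nonempty : exists s, S s.
Proof.
apply: contrapT => /forallNP noS.
suff : (2 %| 1)%N by [].
by apply: S_gcd.2 => d [s /noS].
Qed.

(** If s were the only gap, s.+1 > 1 would divide all of S + 1. *)
Lemma gap_two : exists s s', [/\ S s, S s' & (s < s')%N].
Proof.
have [s Ss] := gap_nonempty; apply: contrapT => no2.
have : (s.+1 %| 1)%N.
  apply: S_gcd.2 => d [s' Ss' <-]; have [ss'|ss'|->//] := ltngtP s s'.
    by exfalso; apply: no2; exists s, s'.
  by exfalso; apply: no2; exists s', s.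
by rewrite dvdn1 eqSS => /eqP s0; have := S_pos Ss; rewrite s0.
Qed.

Local Notation g := (gap_ind R S).
Local Notation e := (prefix_ind R S).

Let g0 j : 0 <= g j. Proof. exact: ler0n. Qed.
Let g1 j : g j <= 1. Proof. by rewrite lern1 leq_b1. Qed.
Let gS s : S s -> g s = 1. Proof. by move=> Ss; rewrite /gap_ind mem_set. Qed.

Lemma gap_series_gt1 : exists n, 1 < series g n.
Proof.
have [s [s' [Ss Ss' ss']]] := gap_two; exists s'.+1.
have := series_ge0_homo g0 ss'; rewrite !seriesSr !gS//.
by have := series_ge0_homo g0 (leq0n s); rewrite {1}/series/= big_geq//; lra.
Qed.

Section WithRoot.
Variable x : R.
Hypothesis x01 : 0 < x < 1.
Let q j := g j * x ^+ j.+1.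
Hypothesis qx : series q @ \oo --> (1 : R).

Let x0 : 0 < x. Proof. by case/andP: x01. Qed.
Let x1 : x < 1. Proof. by case/andP: x01. Qed.
Let q0 j : 0 <= q j. Proof. by rewrite mulr_ge0// exprn_ge0// ltW. Qed.
Let r0 k : 0 <= 1 - series q k.
Proof. by rewrite subr_ge0; exact: series_le_lim. Qed.

Lemma mean_gap_cvg : exists M : R, series (fun k => 1 - series q k) @ \oo --> M.
Proof.
have x1' : x * 1 < 1 by rewrite mulr1.
have tail := sum_tail_le g1 x01 ltr01 x1' g0 qx 0.
have [|M rM _] := series_bounded_cvg (C := x / (1 - x) * ((x * 1) ^+ 0 / (1 - x * 1))) r0.
  move=> n; apply: le_trans (tail n).
  by apply: ler_sum => k _; rewrite expr1n mulr1.
by exists M.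
Qed.

(** The renewal theorem gives the count of words that follow a 1; one more
    convolution with the initial runs of zeros gives the count of all words. *)
Lemma partition_cvg (M B : R) :
  series (fun k => 1 - series q k) @ \oo --> M ->
  series (fun k => e k * x ^+ k) @ \oo --> B ->
  (fun n => (complexity (gap_shift S) n)%:R * x ^+ n) @ \oo --> x * B ^+ 2 / M.
Proof.
move=> rM eB.
have e0 k : 0 <= e k * x ^+ k by rewrite mulr_ge0// exprn_ge0// ltW.
have gcdq : is_gcd [set j.+1 | j in [set j | 0 < q j]] 1.
  suff -> : [set j | 0 < q j] = S by [].
  apply/seteqP; split => j /=.
    rewrite /q /gap_ind; case: (boolP (j \in S)) => [/set_mem//|_].
    by rewrite mul0r ltxx.
  by move=> Sj; rewrite /q gS// mul1r exprn_gt0.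
have tBM : partition_sum (after_one S 0) 1 x @ \oo --> B / M.
  apply: (renewal q0 qx gcdq e0 eB _ rM) => n; rewrite after_one_sum.
  by congr (_ + lagconv _ _ _); apply/funext => j; rewrite mul1r.
have -> : (fun n => (complexity (gap_shift S) n)%:R * x ^+ n) =
    (fun n => e n * x ^+ n + lagconv (fun j => e j * x ^+ j.+1)
       (partition_sum (after_one S 0) 1 x) n).
  apply/funext => n; rewrite complexity_sum before_one_sum.
  by congr (_ + lagconv _ _ _); apply/funext => j; rewrite mul1r.
have -> : x * B ^+ 2 / M = 0 + (x * B) * (B / M) by rewrite expr2; ring.
apply: cvgD; first by apply: cvg_series_cvg_0; apply/cvg_ex; exists B.
apply: cvg_lagconv => //; first by move=> j; rewrite mulr_ge0// exprn_ge0// ltW.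
have -> : series (fun j => e j * x ^+ j.+1) = (fun n => x * series (fun k => e k * x ^+ k) n).
  apply/funext => n; rewrite /series/= mulr_sumr; apply: eq_bigr => j _.
  by rewrite exprS; ring.
exact: cvgMl_tmp.
Qed.

Lemma htop_of_cvg (K : R) : 0 < K ->
  (fun n => (complexity (gap_shift S) n)%:R * x ^+ n) @ \oo --> K ->
  htop R (gap_shift S) = - ln x.
Proof.
move=> K0 cK; apply: cvg_lim => //.
set N := fun n => (complexity (gap_shift S) n)%:R : R.
rewrite -(cvg_shiftS (fun n => n%:R^-1 * ln (N n))).
have cK' := cK; rewrite -(cvg_shiftS (fun n => N n * x ^+ n)) in cK'.
have lim1 : (fun n => n.+1%:R^-1 * ln (N n.+1 * x ^+ n.+1) - ln x) @ \oo --> 0 * ln K - ln x.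
  apply: cvgB; last exact: cvg_cst.
  apply: cvgM; first exact: cvg_harmonic.
  by apply: continuous_cvg; [exact: continuous_ln|exact: cK'].
rewrite mul0r sub0r in lim1; apply: cvg_trans lim1; apply: near_eq_cvg.
have := cvgr_gt K cK' 0 K0 => /(_ _).
apply: filterS => n /= NK.
have Nn : 0 < N n.+1 by move: NK; rewrite pmulr_lgt0// exprn_gt0.
rewrite lnM ?posrE ?exprn_gt0// lnXn// -[ln x *+ _]mulr_natl mulrDr
  [_ * (_ * ln x)]mulrA mulVf ?pnatr_eq0//.
by rewrite mul1r addrK.
Qed.

Variable mu : probability borel_full_shift R.
Let X := gap_shift S.
Let p := word_measure X mu [:: true].
Hypothesis mu_inv : invariant_on X mu.
Hypothesis mu_max : entropy X mu = - ln x.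

(** The entropy bound at z = x * y with c^-1 = 1 + (y - 1) * A, a bound of the
    generating function of q at y.  The terms - ln x cancel, and the logarithms are
    linearised.  Both signs of y - 1 will be used. *)
Let variational (y A : R) : 0 < y -> x * y < 1 -> 0 < 1 + (y - 1) * A ->
  (forall n, series (fun j => q j * y ^+ j.+1) n <= 1 + (y - 1) * A) ->
  y - 1 <= p * y * (y - 1) * A.
Proof.
move=> y0 xy1 d0 qd; set d := 1 + _ in d0 qd.
have p0 : 0 <= p by rewrite fine_ge0.
have h0 : 0 < entropy X mu by rewrite mu_max oppr_gt0 ln_lt0.
have z01 : 0 < x * y < 1 by rewrite xy1 mulr_gt0.
have c0 : 0 < d^-1 by rewrite invr_gt0.
have qd' n : series (fun j => d^-1 * g j * (x * y) ^+ j.+1) n <= 1.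
  have -> : series (fun j => d^-1 * g j * (x * y) ^+ j.+1) n =
      d^-1 * series (fun j => q j * y ^+ j.+1) n.
    rewrite /series/= mulr_sumr; apply: eq_bigr => j _.
    by rewrite /q exprMn; ring.
  by rewrite ler_pdivrMl// mulr1.
have := entropy_le mu_inv h0 c0 z01 qd'.
rewrite mu_max lnM ?posrE// lnV ?posrE// -/p.
have lnd : ln d <= (y - 1) * A.
  by apply: le_ln1Dx; move: d0; rewrite /d; lra.
have plnd : p * ln d <= p * ((y - 1) * A) by rewrite ler_wpM2l.
have lny : - ln y <= y^-1 - 1.
  rewrite -lnV ?posrE// -[y^-1 in leLHS](addrNK 1) addrC.
  by apply: le_ln1Dx; rewrite ltrBDl subrr invr_gt0.
move=> h; have : 1 - y^-1 <= p * ((y - 1) * A) by lra.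
rewrite -(ler_pM2l y0) mulrBr mulfV ?gt_eqF// mulr1 => /le_trans; apply.
by rewrite le_eqVlt; apply/orP; left; apply/eqP; ring.
Qed.

(** For y < 1, partial sums of the tail series are valid constants A in the
    variational inequality, and y --> 1 gives p * M <= 1.  For y > 1, one may take for
    A a partial sum plus a bound T K on the remaining terms, uniform for
    y <= y0; y --> 1 and then K --> oo give 1 <= p * M. *)
Lemma density_mean_gap (M : R) :
  series (fun k => 1 - series q k) @ \oo --> M -> p * M = 1.
Proof.
move=> rM; have p0 : 0 <= p by rewrite fine_ge0.
have rle K := series_le_lim r0 rM K.
have rE n : series (fun k => 1 - series q k) n =
  \sum_(0 <= k < n) (1 - series q k) by [].
apply/eqP; rewrite eq_le; apply/andP; split.
  apply: (ler_cvg_to (cvgMl_tmp (a := p) rM) (cvg_cst (1 : R))); apply: nearW => K.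
  apply: (@le1_of_scaled _ _ K.+1) => y y0 y1.
  have xy1 : x * y < 1 by apply: lt_trans x1; rewrite gtr_pMr.
  pose A := \sum_(0 <= k < K) (1 - series q k) * y ^+ k.
  have qy0 j : 0 <= q j * y ^+ j.+1 by rewrite mulr_ge0// exprn_ge0// ltW.
  have qA n : (K <= n)%N -> series (fun j => q j * y ^+ j.+1) n <= 1 + (y - 1) * A.
    move=> Kn; rewrite (series_scaled _ 1) (big_cat_nat (leq0n K) Kn)/= -/A.
    have h1 : 0 <= (1 - series q n) * y ^+ n by rewrite mulr_ge0// exprn_ge0// ltW.
    have h2 : 0 <= (1 - y) * \sum_(K <= k < n) (1 - series q k) * y ^+ k.
      rewrite mulr_ge0 ?subr_ge0 ?(ltW y1)// sumr_ge0// => k _.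
      by rewrite mulr_ge0// exprn_ge0// ltW.
    by move: h2; rewrite mulrDr mulrBl mul1r; lra.
  have qA' n : series (fun j => q j * y ^+ j.+1) n <= 1 + (y - 1) * A.
    apply: le_trans (qA (maxn K n) (leq_maxl _ _)).
    by apply: series_ge0_homo => //; exact: leq_maxr.
  have d0 : 0 < 1 + (y - 1) * A.
    have [s Ss] := gap_nonempty; apply: lt_le_trans (qA' s.+1).
    rewrite seriesSr ltr_wpDl ?sumr_ge0//.
    by rewrite /q gS// mul1r mulr_gt0 ?exprn_gt0.
  have := variational y0 xy1 d0 qA'.
  have -> : p * y * (y - 1) * A = (y - 1) * (p * y * A) by ring.
  rewrite -[X in X <= _]mulr1 ler_nM2l ?subr_lt0// => /(le_trans _); apply.
  have -> : p * series (fun k => 1 - series q k) K * y ^+ K.+1 =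
      p * y * (series (fun k => 1 - series q k) K * y ^+ K) by rewrite exprS; ring.
  rewrite ler_wpM2l ?mulr_ge0 ?(ltW y0)// rE mulr_suml; apply: ler_sum_nat => k /andP[_ kK].
  by rewrite ler_wpM2l//; apply: ler_wiXn2l; [exact: ltW|exact: ltW|exact: ltnW].
have [y0 y01 xy0] := exists_gt1_mul_lt1 x0 x1.
have xy0' : 0 < x * y0 by rewrite mulr_gt0//; lra.
pose T K := x / (1 - x) * ((x * y0) ^+ K / (1 - x * y0)).
have T0 K : 0 <= T K.
  by rewrite /T mulr_ge0// divr_ge0 ?exprn_ge0// ltW// subr_gt0.
have bound K : 1 <= p * M + p * T K.
  apply: (@le_trans _ _ (p * series (fun k => 1 - series q k) K + p * T K)); last first.
    by rewrite lerD2r ler_wpM2l.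
  apply: (ge1_of_scaled (n := K) y01) => y y1 yy0.
  have y0' : 0 < y by lra.
  have xy1 : x * y < 1 by apply: lt_trans xy0; rewrite ltr_pM2l.
  pose A := series (fun k => 1 - series q k) K * y ^+ K + T K.
  have A0 : 0 <= A.
    by rewrite addr_ge0// mulr_ge0 ?exprn_ge0 ?(ltW y0')// sumr_ge0.
  have d0 : 0 < 1 + (y - 1) * A.
    by rewrite ltr_pwDl// mulr_ge0//; lra.
  have qA n : series (fun j => q j * y ^+ j.+1) n <= 1 + (y - 1) * A.
    rewrite (series_scaled _ 1).
    have h1 : 0 <= (1 - series q n) * y ^+ n by rewrite mulr_ge0// exprn_ge0// ltW.
    have h2 : \sum_(0 <= k < n) (1 - series q k) * y ^+ k <= A.
      have ry k : 0 <= (1 - series q k) * y ^+ k by rewrite mulr_ge0// exprn_ge0// ltW.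
      apply: (@le_trans _ _ (\sum_(0 <= k < maxn K n) (1 - series q k) * y ^+ k)).
        exact: (series_ge0_homo ry (leq_maxr _ _)).
      rewrite (big_cat_nat (leq0n K) (leq_maxl K n))/=; apply: lerD.
        rewrite rE mulr_suml; apply: ler_sum_nat => k /andP[_ kK].
        by rewrite ler_wpM2l//; apply: ler_weXn2l; [exact: ltW|exact: ltnW].
      apply: le_trans (sum_tail_le g1 x01 (lt_trans ltr01 y01) xy0 g0 qx K (maxn K n)).
      apply: ler_sum => k _; rewrite ler_wpM2l//.
      by apply: lerXn2r; rewrite ?nnegrE ?ltW//; lra.
    have : (y - 1) * \sum_(0 <= k < n) (1 - series q k) * y ^+ k <= (y - 1) * A.
      by rewrite ler_pM2l// subr_gt0.
    by lra.
  have := variational y0' xy1 d0 qA.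
  have -> : p * y * (y - 1) * A = (y - 1) * (p * y * A) by ring.
  rewrite -[X in X <= _]mulr1 ler_pM2l ?subr_gt0// => /le_trans; apply.
  by rewrite /A le_eqVlt; apply/orP; left; apply/eqP; ring.
have limT : (fun K => p * M + p * T K) @ \oo --> p * M + p * (x / (1 - x) * (0 / (1 - x * y0))).
  apply: cvgD; first exact: cvg_cst.
  apply: cvgMl_tmp; apply: cvgMl_tmp; apply: cvgMr_tmp.
  by apply: cvg_expr; rewrite ger0_norm// ltW.
rewrite mul0r !mulr0 addr0 in limT.
exact: (ler_cvg_to (cvg_cst (1 : R)) limT (nearW _ bound)).
Qed.

End WithRoot.
End Assembly.

(** * The two cases *)

Lemma prefix_ind_infinite (R : realType) (S : set nat) k :
  infinite_set S -> prefix_ind R S k = 1.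
Proof.
move=> Sinf; rewrite /prefix_ind; case: asboolP => // nok; exfalso; apply: Sinf.
apply: sub_finite_set (finite_II k) => s Ss /=.
by rewrite ltnNge; apply/negP => ks; apply: nok; exists s.
Qed.

Lemma prefix_ind_finite (R : realType) (S : set nat) k :
  (exists s, S s) -> finite_set S -> prefix_ind R S k = (k <= max_set S)%N%:R.
Proof.
move=> [s0 Ss0] Sfin; rewrite /prefix_ind; congr (nat_of_bool _)%:R.
apply/asboolP/idP => [[s Ss ks]|kS].
  apply: leq_trans ks _; apply: leq_bigmax_seq => //.
  by rewrite in_fset_set// mem_set.
apply: contrapT => nok.
have small s : S s -> (s < k)%N.
  by move=> Ss; rewrite ltnNge; apply/negP => ks; apply: nok; exists s.
have k0 : (0 < k)%N by apply: leq_ltn_trans (small _ Ss0).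
suff : (max_set S <= k.-1)%N by move: kS k0; lia.
apply/bigmax_leqP_seq => s; rewrite in_fset_set// => /set_mem Ss _.
by have := small _ Ss; lia.
Qed.

Lemma cvg_truncated_geometric (R : realType) (x : R) m : x < 1 ->
  series (fun k => (k <= m)%N%:R * x ^+ k) @ \oo --> (1 - x ^+ m.+1) / (1 - x).
Proof.
move=> x1; apply: cvg_near_cst; exists m.+1 => // n /= mn.
rewrite /series/= (big_cat_nat (leq0n _) mn)/=.
rewrite [X in _ + X]big_nat_cond [X in _ + X]big1 ?addr0; last first.
  by move=> i /andP[/andP[mi _] _]; rewrite leqNgt mi mul0r.
have := geometric_seriesE 1 (negbT (lt_eqF x1)).
move=> /(congr1 (fun f => f m.+1)) /=; rewrite mul1r => <-.
rewrite /series/=; apply: eq_big_nat => i /andP[_ im].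
by rewrite -ltnS im.
Qed.

(* S is a set of positive integers. *)
Theorem corollary3p20 (R : realType) (S : set nat)
    (S_pos : forall s, S s -> (0 < s)%N)
    (S_gcd : is_gcd [set s.+1 | s in S] 1)
    (mu : probability borel_full_shift R)
    (mu_mme : max_entropy_measure (gap_shift S) mu) :
  let X := gap_shift S in
  let lambda : R := expR (htop R X) in
  let mu1 : R := word_measure X mu [:: true] in
  (infinite_set S ->
    (fun n : nat => (complexity X n)%:R / lambda ^+ n) @ \oo -->
      mu1 * lambda / (lambda - 1) ^+ 2) /\
  (finite_set S ->
    (fun n : nat => (complexity X n)%:R / lambda ^+ n) @ \oo -->
      mu1 * lambda * (1 - lambda ^- (max_set S).+1) ^+ 2 / (lambda - 1) ^+ 2).
Proof.
move=> X lambda mu1; have [mu_inv mu_max] := mu_mme.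
have g0 j : 0 <= gap_ind R S j by exact: ler0n.
have g1 j : gap_ind R S j <= 1 by rewrite lern1 leq_b1.
have [x x01 qx] := root_exists g0 g1 (gap_series_gt1 R S_pos S_gcd).
have /andP[x0 x1] := x01.
have [M rM] := mean_gap_cvg x01 qx.
have xn0 : x != 0 by rewrite gt_eqF.
have x1n0 : 1 - x != 0 by rewrite subr_eq0 gt_eqF.
have main (B : R) : B != 0 -> series (fun k => prefix_ind R S k * x ^+ k) @ \oo --> B ->
    lambda = x^-1 /\
    (fun n : nat => (complexity X n)%:R / lambda ^+ n) @ \oo --> x * B ^+ 2 * mu1.
  move=> Bn0 eB.
  have cX := partition_cvg S_gcd x01 qx rM eB.
  have M0 : 0 < M.
    have r0 k : 0 <= 1 - series (fun j => gap_ind R S j * x ^+ j.+1) k.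
      rewrite subr_ge0; apply: series_le_lim qx _ => j.
      by rewrite mulr_ge0// exprn_ge0// ltW.
    apply: lt_le_trans ltr01 _; have := series_le_lim r0 rM 1%N.
    by rewrite {1}/series/= big_nat1 {1}/series/= big_geq// subr0.
  have K0 : 0 < x * B ^+ 2 / M.
    by rewrite divr_gt0// mulr_gt0// exprn_even_gt0.
  have hX := htop_of_cvg x01 K0 cX.
  have lx : lambda = x^-1 by rewrite /lambda hX -lnV ?posrE// lnK// posrE invr_gt0.
  split=> //.
  have pM : mu1 * M = 1.
    by apply: (density_mean_gap S_gcd x01 qx mu_inv _ rM); rewrite mu_max.
  have -> : mu1 = M^-1 by rewrite -[LHS]mulr1 -(divff (lt0r_neq0 M0)) mulrA pM mul1r.
  rewrite lx; under eq_fun do rewrite exprVn invrK.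
  exact: cX.
split=> [Sinf|Sfin].
  have eB : series (fun k => prefix_ind R S k * x ^+ k) @ \oo --> 1 / (1 - x).
    under [X in series X]funext do rewrite prefix_ind_infinite//.
    by apply: cvg_geometric_series; rewrite ger0_norm// ltW.
  have [|lx cX] := main _ _ eB; first by rewrite mul1r invr_eq0.
  suff -> : mu1 * lambda / (lambda - 1) ^+ 2 = x * (1 / (1 - x)) ^+ 2 * mu1 by [].
  by rewrite lx; field; rewrite ?xn0 ?x1n0.
have eB : series (fun k => prefix_ind R S k * x ^+ k) @ \oo -->
    (1 - x ^+ (max_set S).+1) / (1 - x).
  have -> : (fun k => prefix_ind R S k * x ^+ k) =
      (fun k => (k <= max_set S)%N%:R * x ^+ k).
    by apply/funext => k; rewrite prefix_ind_finite//; exact: gap_nonempty.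
  exact: cvg_truncated_geometric.
have [|lx cX] := main _ _ eB.
  by rewrite mulf_neq0 ?invr_eq0// subr_eq0 eq_sym lt_eqF// exprn_ilt1// ltW.
suff -> : mu1 * lambda * (1 - lambda ^- (max_set S).+1) ^+ 2 / (lambda - 1) ^+ 2 =
    x * ((1 - x ^+ (max_set S).+1) / (1 - x)) ^+ 2 * mu1 by [].
rewrite lx exprVn invrK; set y := x ^+ _.
by field; rewrite ?xn0 ?x1n0.
Qed.
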